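(* Let $k,l,n$ be positive integers. Then $$\binom{kn+ln}{kn}\equiv 0\ \left(\mathrm{mod}\ \frac{ln+1}{\gcd(k,ln+1)}\right).$$ In particular, $(ln+1)\mid\binom{kn+ln}{kn}$ if every prime factor of $k$ divides $l$. *)

(* Defs.v *)
From mathcomp Require Export all_boot.

(* Main.v *)
Require Import Defs.
From mathcomp Require Import all_boot.

(* The identity [(l n + 1) C(N, l n + 1) = k n C(N, l n)] for [N = k n + l n]
   shows that [l n + 1], being coprime to [n], divides [k C(N, l n)]. *)

(** Write [m = l * n + 1] and let [C] be the binomial. By [dvdn_mul_bin], [m] divides [k * C];
    cancelling what [m] shares with [k] ([dvdn_div_gcd]) gives the congruence. For the second claim
    the gcd is 1, as a common prime of [k] and [m] would divide [l], hence 1. *)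

Lemma dvdn_mul_bin (k l n : nat) :
  (l * n).+1 %| k * 'C(k * n + l * n, k * n).
Proof.
have co_n : coprime (l * n).+1 n.
  exact: coprime_dvdr (dvdn_mull l (dvdnn n)) (coprimeSn _).
rewrite -(Gauss_dvdr _ co_n) mulnA (mulnC n) -bin_sub ?leq_addr // addKn.
have := mul_bin_left (k * n + l * n) (l * n).
by rewrite addnK => <-; apply: dvdn_mulr.
Qed.

(** Dividing by [g = gcdn k m] makes [m %/ g] and [k %/ g] coprime, so Gauss's lemma applies to
    [m %/ g %| (k %/ g) * c]. *)
Lemma dvdn_div_gcd (k m c : nat) : 0 < m -> m %| k * c -> m %/ gcdn k m %| c.
Proof.
move=> m_gt0 m_dvd; have g_gt0 : 0 < gcdn k m by rewrite gcdn_gt0 m_gt0 orbT.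
have co_mk : coprime (m %/ gcdn k m) (k %/ gcdn k m).
  rewrite /coprime -(eqn_pmul2r g_gt0) muln_gcdl !divnK ?dvdn_gcdl ?dvdn_gcdr //.
  by rewrite mul1n gcdnC.
rewrite -(Gauss_dvdr _ co_mk) -(dvdn_pmul2r g_gt0) mulnAC.
by rewrite !divnK ?dvdn_gcdl ?dvdn_gcdr.
Qed.

Theorem theorem1p4 (k l n : nat) (hk : 0 < k) (hl : 0 < l) (hn : 0 < n) :
  'C(k * n + l * n, k * n) = 0 %[mod (l * n + 1) %/ gcdn k (l * n + 1)]
  /\ ((forall p : nat, prime p -> p %| k -> p %| l) ->
      l * n + 1 %| 'C(k * n + l * n, k * n)).
Proof.
rewrite addn1.
have dvd_quot := dvdn_div_gcd _ _ _ (ltn0Sn _) (dvdn_mul_bin k l n).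
split=> [|prime_dvd]; first by rewrite mod0n; apply/eqP.
suff /eqP gcd1 : gcdn k (l * n).+1 == 1 by rewrite gcd1 divn1 in dvd_quot.
apply: contraT => gcd_neq1.
have gcd_gt1 : 1 < gcdn k (l * n).+1 by rewrite ltn_neqAle eq_sym gcd_neq1 gcdn_gt0 orbT.
have p_prime := pdiv_prime gcd_gt1; have := pdiv_dvd (gcdn k (l * n).+1).
set p := pdiv _ in p_prime *; rewrite dvdn_gcd => /andP[p_k].
(* As [p] divides [k], it divides [l * n]; dividing [l * n + 1] too, it would divide 1. *)
by rewrite -addn1 dvdn_addr ?Euclid_dvd1 // dvdn_mulr // prime_dvd.
Qed.
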